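(* Let $\boldsymbol{\sigma} = (\sigma_n)_{n\in\mathbb{N}}$ be a primitive and algebraically irreducible sequence of substitutions over $\mathcal{A} = \{1,2\}$. Assume that there is $C > 0$ such that for each $\ell \in \mathbb{N}$, there is $n \ge 1$ with $(\sigma_{n},\ldots,\sigma_{n+\ell-1}) = (\sigma_{0},\ldots,\sigma_{\ell-1})$ and the language $\mathcal{L}_{\boldsymbol{\sigma}}^{(n+\ell)}$ is $C$-balanced. Then $\boldsymbol{\sigma}$ satisfies the strong coincidence condition.
   Context: Let $\mathcal{A}=\{1,2\}$ and let $\mathcal{A}^*$ be the free monoid of finite words over $\mathcal{A}$ (with concatenation). A substitution over $\mathcal{A}$ is an endomorphism of the monoid $\mathcal{A}^*$ sending non-empty words to non-empty words. For $w\in\mathcal{A}^*$, $|w|_i$ is the number of occurrences of the letter $i$ in $w$, and $\mathbf{l}(w) = {}^t(|w|_1,|w|_2)\in\mathbb{N}^2$ is its abelianization. The incidence matrix of $\sigma$ is $M_\sigma = (|\sigma(j)|_i)_{i,j\in\mathcal{A}} \in \mathbb{N}^{2\times 2}$. Here $\mathbb{N}=\{0,1,2,\dots\}$. For a sequence of substitutions $\boldsymbol{\sigma} = (\sigma_n)_{n\in\mathbb{N}}$, put $M_n = M_{\sigma_n}$, $\sigma_{[k,\ell)} = \sigma_k \sigma_{k+1}\cdots\sigma_{\ell-1}$ (composition) and $M_{[k,\ell)} = M_k M_{k+1}\cdots M_{\ell-1}$ for $0\le k\le \ell$. The sequence $\boldsymbol{\sigma}$ is primitive if for each $k\in\mathbb{N}$,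 $M_{[k,\ell)}$ is a positive matrix (all entries $>0$) for some $\ell>k$. It is algebraically irreducible if for each $k\in\mathbb{N}$ the characteristic polynomial of $M_{[k,\ell)}$ is irreducible (over $\mathbb{Q}$) for all sufficiently large $\ell$. The language of level $m\in\mathbb{N}$ is $\mathcal{L}_{\boldsymbol{\sigma}}^{(m)} = \{w\in\mathcal{A}^* : w \text{ is a factor (contiguous subword) of } \sigma_{[m,n)}(i) \text{ for some } i\in\mathcal{A},\ n\in\mathbb{N}\}$ (with $n \ge m$). A language $\mathcal{L}\subseteq\mathcal{A}^*$ is $C$-balanced if for all $u,v\in\mathcal{L}$ of the same length and all $j\in\mathcal{A}$ one has $-C\le |u|_j-|v|_j\le C$. The sequence $\boldsymbol{\sigma}$ satisfies the strong coincidence condition if there is $n\in\mathbb{N}$ such that $\sigma_0\sigma_1\cdots\sigma_n(1)\in p_1 i\mathcal{A}^*$ and $\sigma_0\sigma_1\cdots\sigma_n(2)\in p_2 i\mathcal{A}^*$ for some $i\in\mathcal{A}$ and some words $p_1,p_2\in\mathcal{A}^*$ with $\mathbf{l}(p_1)=\mathbf{l}(p_2)$. *)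

(* Defs.v *)
From mathcomp Require Import all_boot all_order all_algebra.
Set Implicit Arguments.
Unset Strict Implicit.
Unset Printing Implicit Defensive.
Import Order.TTheory GRing.Theory Num.Theory.
Local Open Scope ring_scope.

(* The alphabet {1,2} is 'I_2: the letter 1 is ord0 and the letter 2 is
   ord_max. *)
Definition letter := 'I_2.
Definition letter1 : letter := ord0.
Definition letter2 : letter := ord_max.
Definition word := seq letter.

Record substitution (s : word -> word) : Prop := Substitution {
  subst_nil : s [::] = [::];
  subst_cat : {morph s : u v / u ++ v};
  subst_nonerasing : forall w, w <> [::] -> s w <> [::]
}.

Definition abelianization (w : word) : 'cV[nat]_2 := \col_i count_mem i w.

Definition incidence_mx (s : word -> word) : 'M[nat]_2 :=
  \matrix_(i, j) count_mem i (s [:: j]).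

(* Both products over [k, l) are taken from left to right and are the identity
   when l <= k. *)
Definition subst_comp (sigma : nat -> word -> word) (k l : nat) : word -> word :=
  \big[comp/id]_(k <= n < l) sigma n.

Definition mx_prod (sigma : nat -> word -> word) (k l : nat) : 'M[nat]_2 :=
  \prod_(k <= n < l) incidence_mx (sigma n).

Definition primitive (sigma : nat -> word -> word) : Prop :=
  forall k : nat, exists2 l : nat, (k < l)%N &
    forall i j, (0 < mx_prod sigma k l i j)%N.

Definition algebraically_irreducible (sigma : nat -> word -> word) : Prop :=
  forall k : nat, exists N : nat, forall l : nat, (k <= l)%N -> (N <= l)%N ->
    irreducible_poly
      (char_poly (map_mx (fun a : nat => a%:R : rat) (mx_prod sigma k l))).

Definition language (sigma : nat -> word -> word) (m : nat) (w : word) : Prop :=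
  exists (i : letter) (n : nat),
    (m <= n)%N /\ infix w (subst_comp sigma m n [:: i]).

Definition balanced (R : archiRealFieldType) (C : R) (L : word -> Prop) : Prop :=
  forall u v : word, L u -> L v -> size u = size v ->
  forall j : letter,
    - C <= (count_mem j u)%:R - (count_mem j v)%:R <= C.

Definition strong_coincidence (sigma : nat -> word -> word) : Prop :=
  exists (n : nat) (i : letter) (p1 p2 : word),
    [/\ prefix (p1 ++ [:: i]) (subst_comp sigma 0 n.+1 [:: letter1]),
        prefix (p2 ++ [:: i]) (subst_comp sigma 0 n.+1 [:: letter2]) &
        abelianization p1 = abelianization p2].

(* Main.v *)
Require Import Defs.
From HB Require Import structures.
From mathcomp Require Import all_boot all_order all_algebra.
From mathcomp Require Import reals Rstruct boolp classical_sets.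
From mathcomp Require Import zify ring lra.
Set Implicit Arguments.
Unset Strict Implicit.
Unset Printing Implicit Defensive.
Import Order.TTheory GRing.Theory Num.Theory.
Local Open Scope ring_scope.

(** A word is read as a broken line in the plane, with one unit edge per letter,
and two edges of level k coincide when their images under the composition of
the first k substitutions share an edge. If strong coincidence fails, the two
edges that leave a common point never coincide, at any level; the proof turns
this into a contradiction by following Barge and Diamond.

Call configuration of level l a set of pairwise non-coincident edges that all
cross a given height; the height is a positive linear form, injective on the
lattice. Configurations are confined to a fixed box, so their size is bounded.
Lemma [descent] shows that the maximal size can be lowered by changing the level
and the height, and this cannot go on for ever.

For the descent, recurrence gives m = n + l such that the first m substitutions
end with a copy of the first l ones and the language of level m is balanced.
Take l' much larger than m, and transport a configuration of level l' to level m
through the substitutions of index in [m, l'). Its edges become long strands,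
and the edges of the strands which cross a height form a configuration of level
l with as many elements as the initial one. If the size did not drop, all these
configurations would be maximal. Now a maximal configuration determines the next
one: after the lowest end y of an edge, an edge at y with one letter and an edge
at y with the other letter do not coincide, so two different successors could be
merged into a larger configuration ([same_cut_next_sub]). There are finitely many
configurations up to translation, hence the sequence of configurations is
periodic, and long strands repeat a nonzero vector z many times
([itinerary_periodic]). Balancedness keeps the strands near the line of the
frequency vector ([frequency]), so z lies on this line up to a small error. This
is impossible because algebraic irreducibility makes the frequency irrational
([dev_eq0]).

Two estimates make the boxes uniform. The transported configuration stays near
the line because the maps of [m, l') contract the plane onto it ([contraction]),
which also forces the strands to be long. And the height is compared with its
values on the two letters uniformly ([admissible]): the indices just below l' are
chosen as a copy of an initial block with positive incidence matrix. *)

(** * Broken lines and their coincidences *)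

Notation pt := (int * int)%type.
Notation edge := (pt * letter)%type.

(** Abelianization with values in a group, so that base points may be subtracted
and moved to the origin. *)
Definition ab (w : word) : pt :=
  ((count_mem letter1 w)%:Z, (count_mem letter2 w)%:Z).
Definition tip (e : edge) : pt := e.1 + ab [:: e.2].
Definition shift (z : pt) (e : edge) : edge := (e.1 + z, e.2).

Lemma ab_nil : ab [::] = 0. Proof. by []. Qed.
Lemma ab_cat u v : ab (u ++ v) = ab u + ab v.
Proof. by rewrite /ab !count_cat !PoszD. Qed.
Lemma ab_cons i w : ab (i :: w) = ab [:: i] + ab w.
Proof. by rewrite -cat1s ab_cat. Qed.

Lemma letterP (i : letter) : i = letter1 \/ i = letter2.
Proof.
case: i => [[|[|//]] hi]; [left|right]; exact: val_inj.
Qed.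

Lemma big_letter (T : Type) (idx : T) (op : Monoid.law idx) (F : letter -> T) :
  \big[op/idx]_(i : letter) F i = op (F letter1) (F letter2).
Proof.
by rewrite big_ord_recl big_ord1; congr (op (F _) (F _)); exact: val_inj.
Qed.

Lemma shift_shift x y e : shift x (shift y e) = shift (y + x) e.
Proof. by rewrite /shift /= addrA. Qed.

Lemma shift0 e : shift 0 e = e.
Proof. by rewrite /shift addr0 -surjective_pairing. Qed.

Lemma shift_inj x : injective (shift x).
Proof.
move=> [u i] [v j] E; have /= /addIr -> := congr1 fst E.
by have /= -> := congr1 snd E.
Qed.

Lemma mem_shift x e (K : seq edge) :
  (e \in map (shift x) K) = (shift (- x) e \in K).
Proof.
by rewrite -[RHS](mem_map (@shift_inj x)) shift_shift addNr shift0.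
Qed.

Lemma tip_shift x e : tip (shift x e) = tip e + x.
Proof. by rewrite /tip /= addrAC. Qed.

(** The action of the incidence matrix of [s], written without matrices; it is
meaningful through [lin_ab] when [s] is a morphism. *)
Definition lin (s : word -> word) (x : pt) : pt :=
  ab (s [:: letter1]) *~ x.1 + ab (s [:: letter2]) *~ x.2.

Lemma lin_is_additive s : zmod_morphism (lin s).
Proof. move=> x y; rewrite /lin /= !mulrzBr; ring. Qed.
HB.instance Definition _ s := GRing.isZmodMorphism.Build pt pt (lin s)
  (lin_is_additive s).

Lemma pt_mulrz (x : pt) (n : int) : x *~ n = (x.1 * n, x.2 * n).
Proof.
have e1 := raddfMz (@fst int int) n x; have e2 := raddfMz (@snd int int) n x.
by rewrite -!mulrzz -e1 -e2 -surjective_pairing.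
Qed.

Lemma linE s x : lin s x =
  ((count_mem letter1 (s [:: letter1]))%:Z * x.1 +
   (count_mem letter1 (s [:: letter2]))%:Z * x.2,
   (count_mem letter2 (s [:: letter1]))%:Z * x.1 +
   (count_mem letter2 (s [:: letter2]))%:Z * x.2).
Proof. by rewrite /lin !pt_mulrz. Qed.

Lemma lin_ab s w : substitution s -> lin s (ab w) = ab (s w).
Proof.
case=> s0 sD _; elim: w => [|i w IHw]; first by rewrite s0 !ab_nil raddf0.
rewrite ab_cons raddfD /= IHw -[in RHS]cat1s sD ab_cat; congr (_ + _).
by rewrite /lin; case: (letterP i) => -> /=; rewrite ?mulr1z ?mulr0z ?addr0 ?add0r.
Qed.

Lemma lin_comp s t x : substitution s -> lin (s \o t) x = lin s (lin t x).
Proof. by move=> hs; rewrite [lin t x]/lin raddfD /= !raddfMz /= !lin_ab. Qed.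

Fixpoint strand (x : pt) (w : word) : seq edge :=
  if w is i :: w' then (x, i) :: strand (x + ab [:: i]) w' else [::].

Lemma strand_cat x u v : strand x (u ++ v) = strand x u ++ strand (x + ab u) v.
Proof.
elim: u x => [|i u IHu] x /=; first by rewrite ab_nil addr0.
by rewrite IHu (ab_cons i u) addrA.
Qed.

Lemma strand_shift x z w : strand (x + z) w = map (shift z) (strand x w).
Proof. by elim: w x => //= i w IHw x; rewrite -IHw addrAC. Qed.

Lemma strandP x w (e : edge) :
  reflect (exists p s, w = p ++ e.2 :: s /\ e.1 = x + ab p) (e \in strand x w).
Proof.
apply: (iffP idP) => [|[p [s [-> ep]]]]; last first.
  rewrite strand_cat mem_cat /= inE -ep; by case: e {ep} => y j /=;
    rewrite eqxx orbT.
elim: w x => //= i w IHw x; rewrite inE => /predU1P [->|/IHw[p [s [-> ->]]]].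
  by exists [::], w; rewrite ab_nil addr0.
by exists (i :: p), s; rewrite (ab_cons i p) addrA.
Qed.

Lemma strand_subst s x w (e g : edge) : substitution s ->
  e \in strand x w -> g \in strand (lin s e.1) (s [:: e.2]) ->
  g \in strand (lin s x) (s w).
Proof.
move=> hs /strandP[p [q [-> ->]]] hg; case: (hs) => _ sD _.
by rewrite -cat1s !sD !strand_cat !mem_cat -lin_ab // -raddfD hg orbT.
Qed.

Section Heights.
Context {R : realDomainType} (h : {additive pt -> R}).
Hypothesis h_gt0 : forall i, 0 < h (ab [:: i]).

Lemma height_ab w : 0 <= h (ab w).
Proof.
elim: w => [|i w IHw]; first by rewrite ab_nil raddf0.
by rewrite ab_cons raddfD addr_ge0 // ltW.
Qed.

Lemma strand_ge x w e : e \in strand x w -> h x <= h e.1.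
Proof. by move=> /strandP[p [s [_ ->]]]; rewrite raddfD lerDl height_ab. Qed.

Lemma strand_tip_le x w e : e \in strand x w -> h (tip e) <= h (x + ab w).
Proof.
move=> /strandP[p [s [-> he]]].
by rewrite /tip he ab_cat (ab_cons _ s) !addrA [leRHS]raddfD lerDl height_ab.
Qed.

(** Heights increase along a strand, hence its edges occupy consecutive height
intervals. *)
Lemma strand_trichotomy x w e g : e \in strand x w -> g \in strand x w ->
  [\/ e = g, h (tip e) <= h g.1 | h (tip g) <= h e.1].
Proof.
elim: w x => //= i w IHw x; rewrite !inE.
move=> /predU1P[->|he] /predU1P[->|hg].
- exact: Or31.
- by apply: Or32; exact: strand_ge hg.
- by apply: Or33; exact: strand_ge he.
- exact: IHw he hg.
Qed.

Definition crosses (c : R) (e : edge) := h e.1 <= c < h (tip e).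

Lemma strand_crosses_inj x w c e g : e \in strand x w -> g \in strand x w ->
  crosses c e -> crosses c g -> e = g.
Proof.
move=> he hg /andP[e1 e2] /andP[g1 g2].
by case: (strand_trichotomy he hg) => // hh; exfalso; lra.
Qed.

Lemma strand_crosses x w c : h x <= c < h (x + ab w) ->
  exists2 e, e \in strand x w & crosses c e.
Proof.
elim: w x => [|i w IHw] x /=; first by rewrite ab_nil addr0 =>
  /andP[/le_lt_trans/[apply]]; rewrite ltxx.
rewrite (ab_cons i w) addrA => /andP[hx hc].
have [ci|ci] := ltP c (h (x + ab [:: i])).
  by exists (x, i); rewrite ?mem_head // /crosses /tip /= hx ci.
case: (IHw (x + ab [:: i])); first by rewrite ci hc.
by move=> e he hce; exists e => //; rewrite inE he orbT.
Qed.

End Heights.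

Definition coincide (s : word -> word) (e g : edge) :=
  has (mem (strand (lin s e.1) (s [:: e.2]))) (strand (lin s g.1) (s [:: g.2])).

Lemma coincideP s e g : reflect
  (exists2 x, x \in strand (lin s e.1) (s [:: e.2]) &
    x \in strand (lin s g.1) (s [:: g.2]))
  (coincide s e g).
Proof. by apply: (iffP hasP) => -[x] /=; exists x. Qed.

Lemma coincide_sym s e g : coincide s e g = coincide s g e.
Proof. by apply/coincideP/coincideP => -[x]; exists x. Qed.

Lemma coincide_shift s z e g : coincide s (shift z e) (shift z g) = coincide s e g.
Proof.
rewrite /coincide /= !raddfD !strand_shift has_map; apply: eq_has => x /=.
by rewrite mem_map //; exact: shift_inj.
Qed.

Lemma eq_coincide s t e g : s =1 t -> coincide s e g = coincide t e g.
Proof. by move=> st; rewrite /coincide /lin !st. Qed.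

(** A coincidence of two edges inside the images of [e] and [g] is inherited by
[e] and [g] themselves. *)
Lemma coincide_sub s t e g e' g' : substitution s ->
  e' \in strand (lin t e.1) (t [:: e.2]) ->
    g' \in strand (lin t g.1) (t [:: g.2]) ->
  coincide s e' g' -> coincide (s \o t) e g.
Proof.
move=> hs he hg /coincideP[x xe xg]; apply/coincideP; exists x; rewrite lin_comp //.
  exact: strand_subst he xe.
exact: strand_subst hg xg.
Qed.

(** A common edge of two broken lines has a nonempty image, which is again common
to both. *)
Lemma coincide_image s t e g : substitution s ->
  coincide t e g -> coincide (s \o t) e g.
Proof.
move=> hs /coincideP[x xe xg]; apply: (coincide_sub hs xe xg).
have sx : s [:: x.2] <> [::] by case: hs => _ _; apply.
apply/coincideP; case: (s [:: x.2]) sx => // i w _.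
by exists (lin s x.1, i); exact: mem_head.
Qed.

(** * Compositions of substitutions and their languages *)

Lemma subst_comp_nn sigma k : subst_comp sigma k k = id.
Proof. by rewrite /subst_comp big_geq. Qed.

Lemma subst_compS sigma k l : (k < l)%N ->
  subst_comp sigma k l = sigma k \o subst_comp sigma k.+1 l.
Proof. by move=> kl; rewrite /subst_comp big_ltn. Qed.

Lemma subst_comp_cat sigma k l n : (k <= l)%N -> (l <= n)%N ->
  subst_comp sigma k n = subst_comp sigma k l \o subst_comp sigma l n.
Proof.
move=> /subnKC <-; move: (l - k)%N => d; elim: d k => [|d IHd] k hn.
  by rewrite addn0 subst_comp_nn.
rewrite !(@subst_compS _ k); try lia.
by rewrite -addSnnS IHd // addSnnS.
Qed.

(** Compositions inside a recurring block agree with those of the initial block. *)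
Lemma subst_comp_shift sigma n l :
  (forall k, (k < l)%N -> sigma (n + k)%N =1 sigma k) ->
  forall k, (k <= l)%N ->
  subst_comp sigma (n + k) (n + l) =1 subst_comp sigma k l.
Proof.
move=> hn k /subnKC E; move: (l - k)%N E => d; elim: d k => [|d IHd] k E w.
  by rewrite -E addn0 !subst_comp_nn.
rewrite (@subst_compS _ k) ?(@subst_compS _ (n + k)) /=; try lia.
by rewrite hn -?addnS ?IHd //; lia.
Qed.

Section Words.
Variable sigma : nat -> word -> word.
Hypothesis sigma_subst : forall n, substitution (sigma n).
Local Notation sc := (subst_comp sigma).
Local Notation lang := (language sigma).

Lemma subst_comp_substitution k l : substitution (sc k l).
Proof.
have [lk|/ltnW/subnKC <-] := leqP l k; first by rewrite /subst_comp big_geq //;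
  split.
move: (l - k)%N => d; elim: d k => [|d IHd] k;
  first by rewrite addn0 subst_comp_nn; split.
rewrite subst_compS -?addSnnS; last by lia.
have [n0 nD n1] := sigma_subst k; have [d0 dD d1] := IHd k.+1.
by split=> [|u v|w /d1/n1 //] /=; rewrite ?d0 ?dD ?nD.
Qed.
Hint Resolve subst_comp_substitution : core.

Lemma subst_comp_cat_word k l u v : sc k l (u ++ v) = sc k l u ++ sc k l v.
Proof. by case: (subst_comp_substitution k l). Qed.

Lemma count_subst s w i : substitution s ->
  count_mem i (s w) = (\sum_j count_mem i (s [:: j]) * count_mem j w)%N.
Proof.
case=> s0 sD _; rewrite big_letter; elim: w => [|j w IHw];
  first by rewrite s0 !muln0.
rewrite -cat1s sD !count_cat {}IHw /= !addn0.
by case: (letterP j) => -> /=; ring.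
Qed.

Lemma mx_prodE k l i j : mx_prod sigma k l i j = count_mem i (sc k l [:: j]).
Proof.
have [lk|/ltnW/subnKC <-] := leqP l k.
  rewrite /mx_prod /subst_comp !big_geq // mxE /= addn0 eq_sym.
  by case: eqP.
move: (l - k)%N => d; elim: d k i j => [|d IHd] k i j.
  by rewrite /mx_prod /subst_comp !big_geq ?addn0 // mxE /= addn0 eq_sym; case: eqP.
rewrite /mx_prod big_ltn; last by lia.
rewrite mxE subst_compS; last by lia.
rewrite /= count_subst //; apply: eq_bigr => a _.
by rewrite mxE -addSnnS -IHd.
Qed.

Lemma lang_infix m u w : lang m w -> infix u w -> lang m u.
Proof.
by case=> i [n [mn wn]] uw; exists i, n; split=> //; exact: infix_trans uw wn.
Qed.

Lemma lang_image m n w : (m <= n)%N -> lang n w -> lang m (sc m n w).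
Proof.
move=> mn [i [k [nk /infixP[p [q E]]]]]; exists i, k; split;
  first exact: leq_trans nk.
apply/infixP; exists (sc m n p), (sc m n q).
by rewrite (@subst_comp_cat _ m n) //= E !subst_comp_cat_word.
Qed.

Lemma lang_sc m n i : (m <= n)%N -> lang m (sc m n [:: i]).
Proof. by move=> mn; exists i, n; split=> //; exact: infix_refl. Qed.

Hypothesis sigma_prim : primitive sigma.

Lemma primitive_mem k : exists2 l, (k < l)%N &
  forall n i j, (l <= n)%N -> j \in sc k n [:: i].
Proof.
have [l kl hl] := sigma_prim k; exists l => // n i j ln.
rewrite (@subst_comp_cat _ k l) ?(ltnW kl) //=.
have : sc l n [:: i] <> [::] by case: (subst_comp_substitution l n) => _ _; apply.
case: (sc l n [:: i]) => // a w _; rewrite -cat1s subst_comp_cat_word mem_cat.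
have := hl j a; rewrite mx_prodE -has_count has_pred1 => -> //.
Qed.

Lemma size_sc_ge m N : exists2 n, (m <= n)%N & forall i, (N <= size (sc m n [::
  i]))%N.
Proof.
elim: N => [|N [n mn hn]]; first by exists m.
have [l nl hl] := primitive_mem n; exists l => [|i]; first lia.
rewrite (@subst_comp_cat _ m n) ?(ltnW nl) //=.
have h1 := hl l i letter1 (leqnn _); have h2 := hl l i letter2 (leqnn _).
case: (sc n l [:: i]) h1 h2 => [|a [|b w]] //.
  by rewrite !inE => /eqP <- /eqP.
move=> _ _; rewrite -cat1s -[b :: w]cat1s !subst_comp_cat_word !size_cat.
have h3 : sc m n [:: b] <> [::] by case: (subst_comp_substitution m n) => _ _;
  apply.
have := hn a; case: (sc m n [:: b]) h3 => //= c v _; lia.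
Qed.

Lemma lang_size m N : exists2 w, lang m w & size w = N.
Proof.
have [n mn hn] := size_sc_ge m N.
exists (take N (sc m n [:: letter1])); last by rewrite size_takel.
apply: lang_infix (lang_sc _ mn) _; apply/infixP.
by exists [::], (drop N (sc m n [:: letter1])); rewrite cat_take_drop.
Qed.

Lemma lang_inner m j : exists x y, lang m [:: x; j; y].
Proof.
have [n mn hn] := primitive_mem m.
have [[|a [|b [|c [|//]]]] // habc _] := lang_size n 3.
have := lang_image (ltnW mn) habc.
have -> : [:: a; b; c] = [:: a] ++ [:: b] ++ [:: c] by [].
rewrite !subst_comp_cat_word; have := hn n b j (leqnn n).
have ne i : sc m n [:: i] <> [::] by case: (subst_comp_substitution m n) =>
  _ _; apply.
case/splitPr => p q.
case/lastP E1: (sc m n [:: a] ++ p) => [|u x].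
  by have := ne a; case: (sc m n [:: a]) E1.
case E2: (q ++ sc m n [:: c]) => [|y v].
  by have := ne c; case: q E2 => //= ->.
rewrite -catA /= E2 catA E1 => h; exists x, y; apply: lang_infix h _.
by apply/infixP; exists u, v; rewrite cat_rcons.
Qed.

(** By primitivity the letter whose image contains [w] occurs in every image of a
letter from a later level. *)
Lemma lang_return m w : lang m w ->
  exists2 N, (m <= N)%N & forall n i, (N <= n)%N -> infix w (sc m n [:: i]).
Proof.
case=> j [n0 [mn0 hw]]; have [l nl hl] := primitive_mem n0.
exists l => [|n i ln]; first lia.
have := hl n i j ln; rewrite (@subst_comp_cat _ m n0) //=; last by lia.
case/splitPr => p q; rewrite -cat1s !subst_comp_cat_word.
exact/infix_catl/infix_catr.
Qed.

End Words.

(** * Letter frequency of a balanced language *)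

(** Displacement of [x] from the line with frequency [alpha] of the first letter,
measured at constant length: it is a linear form that vanishes on this line. *)
Definition dev {R : realType} (alpha : R) (x : pt) : R :=
  x.1%:~R - alpha * (x.1 + x.2)%:~R.

Lemma dev_is_additive (R : realType) (alpha : R) : zmod_morphism (dev alpha).
Proof. by move=> x y; rewrite /dev /= !(intrD, rmorphN); ring. Qed.
HB.instance Definition _ (R : realType) (alpha : R) :=
  GRing.isZmodMorphism.Build pt R (dev alpha) (dev_is_additive alpha).

(** Balancedness with an integer constant, which frees the argument from the
ordered field in which the constant was given. *)
Definition nat_balanced (C : nat) (L : word -> Prop) : Prop :=
  forall u v, L u -> L v -> size u = size v ->
  forall j : letter, (count_mem j u <= count_mem j v + C)%N.

Lemma size_word (w : word) :
  size w = (count_mem letter1 w + count_mem letter2 w)%N.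
Proof.
elim: w => //= i w ->; case: (letterP i) => -> /=; lia.
Qed.

Lemma pigeonhole (T : finType) (f : nat -> T) :
  exists i j, [/\ (i < j)%N, (j <= #|T|)%N & f i = f j].
Proof.
have /injectivePn[i [j nij fij]] : ~~ injectiveb (fun i : 'I_#|T|.+1 => f i).
  by apply/negP => /injectiveP/leq_card; rewrite card_ord ltnn.
have := ltn_ord i; have := ltn_ord j; rewrite !ltnS.
have [ij|ji|/val_inj E] := ltngtP i j; last by rewrite E eqxx in nij.
- by exists i, j.
- by exists j, i.
Qed.

Section Frequency.
Variable sigma : nat -> word -> word.
Hypothesis sigma_subst : forall n, substitution (sigma n).
Hypothesis sigma_prim : primitive sigma.
Variables (m C : nat).
Local Notation sc := (subst_comp sigma).
Local Notation L := (language sigma m).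
Hypothesis L_balanced : nat_balanced C L.

Lemma count_blocks k u w : L u -> L w -> size w = (k * size u)%N ->
  (count_mem letter1 w <= k * (count_mem letter1 u + C))%N /\
  (k * count_mem letter1 u <= count_mem letter1 w + k * C)%N.
Proof.
move=> Lu; elim: k w => [|k IHk] w Lw sw; first by have := size_word w; lia.
have su : size (take (size u) w) = size u by rewrite size_takel; lia.
have Lt : L (take (size u) w).
  apply: lang_infix Lw _; apply/infixP.
  by exists [::], (drop (size u) w); rewrite cat_take_drop.
have Ld : L (drop (size u) w).
  apply: lang_infix Lw _; apply/infixP.
  by exists (take (size u) w), [::]; rewrite cats0 cat_take_drop.
have [|h1 h2] := IHk _ Ld; first by rewrite size_drop; lia.
have h3 := L_balanced Lt Lu su letter1.
have h4 := L_balanced Lu Lt (esym su) letter1.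
have := count_cat (pred1 letter1) (take (size u) w) (drop (size u) w).
rewrite cat_take_drop; lia.
Qed.

(** A word of length [size u * size v] can be cut into blocks of either length, so
its letter count is close to both predictions. *)
Lemma frequency_cross u v : L u -> L v ->
  (count_mem letter1 u * size v <=
   count_mem letter1 v * size u + C * (size u + size v))%N.
Proof.
move=> Lu Lv.
have [w Lw sw] := lang_size sigma_subst sigma_prim m (size u * size v).
have [] := count_blocks Lv Lw sw.
have [] := count_blocks Lu Lw (etrans sw (mulnC _ _)).
lia.
Qed.

(** The bounds of [frequency_cross] separate the lower estimates of the frequency
given by each word from the upper ones, so their supremum lies between them. *)
Lemma frequency (R : realType) : exists alpha : R, [/\ 0 <= alpha, alpha <= 1 &
  forall u, L u -> `|dev alpha (ab u)| <= C%:R].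
Proof.
pose S : set R := [set x | exists u, [/\ L u, (0 < size u)%N &
   x = ((count_mem letter1 u)%:R - C%:R) / (size u)%:R]]%classic.
have Sub v : L v -> (0 < size v)%N ->
    ubound S (((count_mem letter1 v)%:R + C%:R) / (size v)%:R).
  move=> Lv v0 x [u [Lu u0 ->]].
  rewrite ler_pdivrMr ?ltr0n // mulrAC ler_pdivlMr ?ltr0n //.
  have := frequency_cross Lu Lv; rewrite -(ler_nat R) !(natrD, natrM); lra.
have [v Lv sv] := lang_size sigma_subst sigma_prim m 1.
have Ssup : has_sup S.
  split; last by exists (((count_mem letter1 v)%:R + C%:R) / (size v)%:R);
    apply: Sub; rewrite ?sv.
  by exists (((count_mem letter1 v)%:R - C%:R) / (size v)%:R), v; rewrite sv.
have devE a u : dev a (ab u) = (count_mem letter1 u)%:R - a * (size u)%:R :> R.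
  by rewrite /dev size_word /= -PoszD -!pmulrn.
have bd u : L u -> `|dev (sup S) (ab u)| <= C%:R.
  move=> Lu; rewrite devE; have [/size0nil->|u0] := posnP (size u).
    by rewrite mulr0 subr0 normr0.
  have u0' : 0 < (size u)%:R :> R by rewrite ltr0n.
  have := ge_sup Ssup.1 (Sub u Lu u0); rewrite ler_pdivlMr //.
  have : ((count_mem letter1 u)%:R - C%:R) / (size u)%:R <= sup S.
    by apply: sup_upper_bound => //; exists u.
  rewrite ler_pdivrMr // => h1 h2; rewrite ler_norml; apply/andP; split; lra.
exists (sup S); split=> //; rewrite leNgt; apply/negP => neg.
- pose N := (Num.bound (C%:R / - sup S)).+1.
  have hN : C%:R / - sup S < N%:R.
    apply: lt_trans (_ : (Num.bound (C%:R / - sup S))%:R < _);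
      last by rewrite ltr_nat.
    by apply: archi_boundP; rewrite divr_ge0 ?ler0n ?oppr_ge0 ?ltW.
  have [u Lu su] := lang_size sigma_subst sigma_prim m N.
  have := bd u Lu; rewrite devE ler_norml su => /andP[_].
  rewrite ltr_pdivrMr in hN; last by rewrite oppr_gt0.
  by have := ler0n R (count_mem letter1 u); lra.
- have n1 : 0 < sup S - 1 by lra.
  pose N := (Num.bound (C%:R / (sup S - 1))).+1.
  have hN : C%:R / (sup S - 1) < N%:R.
    apply: lt_trans (_ : (Num.bound (C%:R / (sup S - 1)))%:R < _);
      last by rewrite ltr_nat.
    by apply: archi_boundP; rewrite divr_ge0 ?ler0n ?ltW.
  have [u Lu su] := lang_size sigma_subst sigma_prim m N.
  have := bd u Lu; rewrite devE ler_norml su => /andP[+ _].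
  rewrite ltr_pdivrMr // in hN.
  have : (count_mem letter1 u)%:R <= N%:R :> R
    by rewrite ler_nat -su size_word leq_addr.
  lra.
Qed.

End Frequency.

(** * Irrationality of the frequency *)

(** An eigenvalue in the base field is a root of the characteristic polynomial,
which then has a linear factor. *)
Lemma no_rational_eigenvalue (F : fieldType) (A : 'M[F]_2) (lambda : F)
    (v : 'rV[F]_2) :
  irreducible_poly (char_poly A) -> v *m A = lambda *: v -> v = 0.
Proof.
move=> [_ irrA] vA; apply/eqP/negPn/negP => v0.
have : eigenvalue A lambda by apply/eigenvalueP; exists v.
rewrite eigenvalue_root_char -dvdp_XsubCl => /irrA.
rewrite size_XsubC => /(_ isT)/eqp_size; rewrite size_XsubC size_char_poly //.
Qed.

Section Irreducible.
Variable sigma : nat -> word -> word.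
Hypothesis sigma_subst : forall n, substitution (sigma n).
Hypothesis sigma_irr : algebraically_irreducible sigma.
Local Notation sc := (subst_comp sigma).

Definition rat_mx k l : 'M[rat]_2 :=
  map_mx (fun a : nat => a%:R : rat) (mx_prod sigma k l).

Lemma rat_mx_mul k l n : (k <= l)%N -> (l <= n)%N ->
  rat_mx k n = rat_mx k l *m rat_mx l n.
Proof.
move=> kl ln; apply/matrixP => i j; rewrite !mxE mx_prodE //.
rewrite (subst_comp_cat sigma kl ln) /= count_subst;
  last exact: subst_comp_substitution.
rewrite natr_sum; apply: eq_bigr => a _; by rewrite !mxE !mx_prodE // natrM.
Qed.

(** Zero is not an eigenvalue of a long product, so each of its factors is
invertible. *)
Lemma rat_mx_unit k l : (k <= l)%N -> rat_mx k l \in unitmx.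
Proof.
move=> kl; have [N hN] := sigma_irr k.
have := hN (maxn l N) (leq_trans kl (leq_maxl _ _)) (leq_maxr _ _) => irr.
have : rat_mx k (maxn l N) \in unitmx.
  rewrite -row_free_unit -kermx_eq0; apply/rowV0P => v /sub_kermxP v0.
  by apply: (no_rational_eigenvalue (lambda := 0) irr); rewrite v0 scale0r.
by rewrite (@rat_mx_mul k l) ?leq_maxl // unitmx_mul => /andP[].
Qed.

Lemma lin_inj k l : (k <= l)%N -> injective (lin (sc k l)).
Proof.
move=> kl; apply: raddf_inj => x x0.
pose v : 'cV[rat]_2 := \col_i (if i == letter1 then x.1%:~R else x.2%:~R).
have v0 : rat_mx k l *m v = 0.
  apply/matrixP => i j; rewrite !mxE.
  rewrite big_letter /= !mxE /= !mx_prodE //.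
  move: x0 => /=; rewrite linE => -[e1 e2].
  rewrite !pmulrn -!intrM -intrD; apply/eqP; rewrite intr_eq0; apply/eqP.
  by case: (letterP i) => ->.
have : v = 0 by rewrite -(mulKmx (rat_mx_unit kl) v) v0 mulmx0.
move=> /matrixP E; have := E letter1 0; have := E letter2 0.
rewrite !mxE /= => /eqP + /eqP; rewrite !intr_eq0.
by case: x {x0 v v0 E} => a b /= /eqP -> /eqP ->.
Qed.

(** If a lattice point [z] lay on the line, [dev alpha] would be proportional to an
integer form [g] which takes finitely many values on the words of the language.
Its pullbacks to later levels then repeat, and the equality of two of them gives
an irreducible product of incidence matrices the eigenvalue 1. *)
Lemma dev_eq0 (R : realType) (alpha : R) (m C : nat) (z : pt) :
  (forall u, language sigma m u -> `|dev alpha (ab u)| <= C%:R) ->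
  dev alpha z = 0 -> z = 0.
Proof.
move=> bd z0.
pose g (x : pt) : int := z.2 * x.1 - z.1 * x.2.
pose B : nat := (absz (z.1 + z.2)%R * C)%N.
have z1E : alpha * (z.1%:~R + z.2%:~R) = z.1%:~R.
  by move: z0; rewrite /dev intrD; lra.
have gE x : (g x)%:~R = (z.1 + z.2)%:~R * dev alpha x :> R.
  rewrite /g /dev !(intrD, rmorphN, intrM) /= mulrBr [X in _ = _ - X]mulrCA
    mulrA z1E.
  ring.
have gB u : language sigma m u -> - B%:Z <= g (ab u) <= B%:Z.
  move=> /bd devu; rewrite -ler_norml -(ler_int R) intr_norm gE normrM /B PoszM
    intrM abszE.
  by rewrite intr_norm ler_wpM2l.
(* [N k] is an index from which the products starting at level k are irreducible;
   the levels [nn i] are spaced so that this holds between any two of them. *)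
have [N hN] := choice sigma_irr.
pose nn := fix nn i := if i is i'.+1 then maxn (nn i') (N (nn i')) else m.
have nn_mono i j : (i <= j)%N -> (nn i <= nn j)%N.
  by move=> /subnKC <-; elim: (j - i)%N => [|d IHd];
    rewrite ?addn0 ?addnS //= (leq_trans IHd) ?leq_maxl.
pose r n : 'rV[rat]_2 := \row_j (g (ab (sc m n [:: j])))%:~R.
have rM n l : (m <= n)%N -> (n <= l)%N -> r l = r n *m rat_mx n l.
  move=> mn nl; apply/rowP => j; rewrite !mxE.
  rewrite big_letter /= !mxE !mx_prodE // !pmulrn -!intrM -intrD; congr (_%:~R).
  rewrite (subst_comp_cat sigma mn nl) /= -lin_ab;
    last exact: subst_comp_substitution.
  by rewrite /lin !pt_mulrz /g /=; ring.
(* The offset by [B] makes the values of [g] natural numbers, at most [B + B]. *)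
pose code n : 'I_(B + B).+1 * 'I_(B + B).+1 :=
  (inord (absz (g (ab (sc m n [:: letter1])) + B)),
    inord (absz (g (ab (sc m n [:: letter2])) + B))).
have [i [j [ij _ [c1 c2]]]] := pigeonhole (code \o nn).
have mi : (m <= nn i)%N by exact: (nn_mono 0%N).
have ninj : (nn i <= nn j)%N by apply: nn_mono; exact: ltnW.
have rij : r (nn i) = r (nn j).
  have gBi k a :=
    gB _ (lang_sc sigma a (leq_trans mi (nn_mono _ _ (leq_addr k i)))).
  have := gBi 0%N; have := gBi (j - i)%N;
    rewrite addn0 subnKC ?(ltnW ij) // => gBj {}gBi.
  apply/rowP => a; rewrite !mxE; congr (_%:~R).
  have D u v : - B%:Z <= u <= B%:Z -> - B%:Z <= v <= B%:Z ->
      inord (absz (u + B)) = inord (absz (v + B)) :> 'I_(B + B).+1 -> u = v.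
    by move=> hu hv /(congr1 (@nat_of_ord _)); rewrite !inordK; lia.
  by case: (letterP a) => ->; apply: D.
have irr : irreducible_poly (char_poly (rat_mx (nn i) (nn j))).
  by apply: hN ninj _; apply: leq_trans (nn_mono _ _ ij); rewrite /= leq_maxr.
have ri0 : r (nn i) = 0.
  by apply: (no_rational_eigenvalue (lambda := 1) irr); rewrite scale1r -rM.
have r0 : r m = 0 by rewrite -(mulmxK (rat_mx_unit mi) (r m)) -rM // ri0 mul0mx.
move/rowP: r0 => r0; have := r0 letter1; have := r0 letter2.
rewrite !mxE subst_comp_nn /g /= !(mulr0, mulr1, subr0, sub0r).
move=> /eqP + /eqP; rewrite !intr_eq0 oppr_eq0 => /eqP a0 /eqP b0.
by rewrite (surjective_pairing z) a0 b0.
Qed.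

End Irreducible.

(** * Contraction onto the line of the frequency vector *)

Lemma alternating_ab k (u : word) : (forall i, ~~ infix [:: i; i] u) ->
  size u = (k + k)%N -> ab u = (k%:Z, k%:Z).
Proof.
elim: k u => [|k IHk] u alt su; first by rewrite (size0nil su).
case: u alt su => [|a [|b u]] alt su; try by move: su => /=; lia.
have nab : a != b.
  by apply: contra (alt a) => /eqP <-; apply/infixP; exists [::], u.
have [] : ab u = (k%:Z, k%:Z).
  apply: IHk => [i|]; last by move: su => /=; lia.
  by apply: contra (alt i) => /infixP[p [q ->]]; apply/infixP;
    exists (a :: b :: p), q.
by move: nab; rewrite /ab; case: (letterP a) => ->;
  case: (letterP b) => -> //= _ E1 E2; congr (_, _); lia.
Qed.

Section Contraction.
Variable sigma : nat -> word -> word.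
Hypothesis sigma_subst : forall n, substitution (sigma n).
Hypothesis sigma_prim : primitive sigma.
Hypothesis sigma_irr : algebraically_irreducible sigma.
Local Notation sc := (subst_comp sigma).
Variables (R : realType) (alpha : R) (m C : nat).
Local Notation L := (language sigma).
Hypothesis dev_le : forall u, L m u -> `|dev alpha (ab u)| <= C%:R.

Lemma bounded_multiples (x : R) : (forall k : nat, `|x *+ k| <= C%:R) -> x = 0.
Proof.
move=> bd; apply/eqP/negPn/negP => x0.
have x0' : 0 < `|x| by rewrite normr_gt0.
have := archi_boundP (divr_ge0 (ler0n R C) (normr_ge0 x)).
move: (Num.bound _) => N; rewrite ltr_pdivrMr // mulr_natl => hN.
have := bd N.+1; rewrite normrMn mulrS; lra.
Qed.

(** Otherwise every word of level [n] alternates between the two letters, and the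
image of (1, 1) is a lattice point of the line. *)
Lemma lang_square n : (m <= n)%N -> exists i, L n [:: i; i].
Proof.
move=> mn; apply: contrapT => noL.
have /(lin_inj sigma_subst sigma_irr mn) // : lin (sc m n) (1, 1) = lin (sc m n) 0.
rewrite raddf0; apply: (dev_eq0 sigma_subst sigma_irr dev_le).
apply: bounded_multiples => k.
have [u Lu su] := lang_size sigma_subst sigma_prim n (k + k).
have := dev_le (lang_image sigma_subst mn Lu).
rewrite -lin_ab ?(alternating_ab _ su); last exact: subst_comp_substitution.
  have -> : (k%:Z, k%:Z) = (1, 1) *+ k :> pt.
    by rewrite (pmulrn _ k) pt_mulrz !mul1r.
  by rewrite !raddfMn.
move=> i; apply/negP => hi; apply: noL; exists i; exact: lang_infix Lu hi.
Qed.

(** If [w] almost maximizes the deviation, its occurrences in two images of the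
letter [i] must start at almost the same deviation, since otherwise the factor
that goes from one of them to the other beats the maximum. *)
Lemma dev_return_word eps w n i v : (m <= n)%N -> L m w ->
  (forall u, L m u -> `|dev alpha (ab u)| <= `|dev alpha (ab w)| + eps) ->
  infix w (sc m n [:: i]) -> L n (i :: v ++ [:: i]) ->
  `|dev alpha (ab (sc m n (i :: v)))| <= eps.
Proof.
move=> mn Lw wmax /infixP[p [q E]] /(lang_image sigma_subst mn).
rewrite -[_ :: _]cat1s -[i :: v]cat1s !subst_comp_cat_word // E => LX.
set S := sc m n v in LX *.
have h1 : L m (w ++ q ++ S ++ p ++ w).
  by apply: lang_infix LX _; apply/infixP; exists p, q; rewrite !catA.
have h2 : L m (q ++ S ++ p).
  by apply: lang_infix h1 _; apply/infixP; exists w, w; rewrite !catA.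
move: (wmax _ h1) (wmax _ h2); rewrite !ab_cat !raddfD /=.
move: (dev _ (ab w)) (dev _ (ab p)) (dev _ (ab q)) (dev _ (ab S)) => a b c d.
rewrite !ler_norml => /andP[g1 g2] /andP[g3 g4].
by move: g1 g2 g3 g4; case: (ler0P a) => ha g1 g2 g3 g4; apply/andP; split; lra.
Qed.

(** By [dev_return_word] the image of a return word to a letter has a small
deviation. Some square [a a] occurs, so the letter [a] is such a word; the
other letter occurs either in a square or between two letters [a]. *)
Lemma contraction eps : 0 < eps -> exists2 N, (m <= N)%N &
  forall n i, (N <= n)%N -> `|dev alpha (ab (sc m n [:: i]))| <= eps.
Proof.
move=> e0; have e20 : 0 < eps / 2 by lra.
pose S : set R := [set x | exists2 u, L m u & x = `|dev alpha (ab u)|]%classic.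
have Ssup : has_sup S.
  split; last by exists C%:R => x [u /dev_le + ->].
  by have [w Lw _] := lang_size sigma_subst sigma_prim m 0;
    exists `|dev alpha (ab w)|, w.
have [_ [w Lw ->] hw] := sup_adherent e20 Ssup.
have wmax u : L m u -> `|dev alpha (ab u)| <= `|dev alpha (ab w)| + eps / 2.
  by move=> Lu; have : `|dev alpha (ab u)| <= sup S;
    [apply: sup_upper_bound => //; exists u|lra].
have [N mN hN] := lang_return sigma_subst sigma_prim Lw.
exists N => // n i Nn; have mn : (m <= n)%N by exact: leq_trans Nn.
have ret j v := dev_return_word (v := v) mn Lw wmax (hN n j Nn).
have [a Laa] := lang_square mn.
have /= a0 := ret a [::] Laa.
have [->|nia] := eqVneq i a; first by apply: le_trans a0 _; lra.
have [x [y Lxy]] := lang_inner sigma_subst sigma_prim n i.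
have [xa|xi] := eqVneq x i.
  have /(ret i [::]) /= : L n [:: i; i].
    by apply: lang_infix Lxy _; rewrite xa; apply/infixP; exists [::], [:: y].
  by move=> h; apply: le_trans h _; lra.
have [ya|yi] := eqVneq y i.
  have /(ret i [::]) /= : L n [:: i; i].
    by apply: lang_infix Lxy _; rewrite ya; apply/infixP; exists [:: x], [::].
  by move=> h; apply: le_trans h _; lra.
have other b : b != i -> b = a.
  by move: nia; case: (letterP i) => ->; case: (letterP a) => ->;
    case: (letterP b) => ->.
move: Lxy; rewrite (other x) // (other y) // => /(ret a [:: i]).
move: a0; rewrite -(cat1s a [:: i]) subst_comp_cat_word // ab_cat raddfD /=.
rewrite !ler_norml => /andP[h1 h2] /andP[h3 h4]; apply/andP; split; lra.
Qed.
End Contraction.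

(** * Bounded configurations of edges *)

Definition inbox (B : nat) (x : pt) := (absz x.1 <= B)%N && (absz x.2 <= B)%N.

Definition box (B : nat) : seq pt :=
  let ints := [seq k%:Z - B%:Z | k <- iota 0 (B + B).+1] in
  [seq (x, y) | x <- ints, y <- ints].

Lemma mem_box B x : inbox B x -> x \in box B.
Proof.
case: x => a b /andP[/= ha hb]; apply/allpairsP; exists (a, b); split=> //.
- by apply/mapP; exists (absz (a + B%:Z)); rewrite ?mem_iota /=; lia.
- by apply/mapP; exists (absz (b + B%:Z)); rewrite ?mem_iota /=; lia.
Qed.

Lemma inboxD A B x y : inbox A x -> inbox B y -> inbox (A + B) (x + y).
Proof. by rewrite /inbox /= => /andP[? ?] /andP[? ?]; lia. Qed.

Lemma inboxN A x : inbox A (- x) = inbox A x.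
Proof. by rewrite /inbox /= !abszN. Qed.

Lemma inboxW A B x : (A <= B)%N -> inbox A x -> inbox B x.
Proof. by rewrite /inbox => ? /andP[? ?]; lia. Qed.

Lemma inbox_ab1 i : inbox 1 (ab [:: i]).
Proof. by case: (letterP i) => ->. Qed.

(** Irrationality is used through this gap: a nonzero point of a bounded region
cannot be close to the line. *)
Lemma dev_gap (R : realType) (alpha : R) B : (forall z, dev alpha z = 0 -> z = 0) ->
  exists2 d, 0 < d & forall z, inbox B z -> z != 0 -> d <= `|dev alpha z|.
Proof.
move=> inj; suff [d d0 hd] : exists2 d, 0 < d & forall z, z \in box B ->
  z != 0 -> d <= `|dev alpha z|.
  by exists d => // z /mem_box; exact: hd.
elim: (box B) => [|x s [d d0 IHs]]; first by exists 1.
have [x0|x0] := eqVneq x 0.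
  by exists d => // z; rewrite inE x0 => /predU1P[->|/IHs //]; rewrite eqxx.
have dx : 0 < `|dev alpha x| by rewrite normr_gt0; apply: contra x0 => /eqP/inj/eqP.
exists (Num.min d `|dev alpha x|); first by rewrite lt_min d0 dx.
move=> z; rewrite inE ge_min => /predU1P[-> _|zs /(IHs z zs) ->//].
by rewrite lexx orbT.
Qed.

Section Config.
Context {R : realType} (h : {additive pt -> R}).

(** Configurations are translated so that the height which they cross is 0, attained
at the origin; the box then bounds their size. *)
Definition config (D : nat) (s : word -> word) (K : seq edge) : Prop :=
  [/\ uniq K, (forall e, e \in K -> inbox D e.1 /\ crosses h 0 e) &
      forall e g, e \in K -> g \in K -> e != g -> ~~ coincide s e g].

(** The ratio bound prevents the level lines of the height from being nearly
parallel to the line of the frequency vector; [kappa] is the same at all levels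
of the descent. *)
Record admissible (kappa : nat) : Prop := Admissible {
  height_gt0 : forall i, 0 < h (ab [:: i]);
  height_inj : forall z, h z = 0 -> z = 0;
  height_ratio : forall i j, h (ab [:: i]) <= kappa%:R * h (ab [:: j]) }.

Lemma heightE x :
  h x = x.1%:~R * h (ab [:: letter1]) + x.2%:~R * h (ab [:: letter2]).
Proof.
have -> : x = ab [:: letter1] *~ x.1 + ab [:: letter2] *~ x.2.
  by rewrite !pt_mulrz; case: x => a b; congr (_, _) => /=; ring.
by rewrite raddfD !raddfMz /= !pt_mulrz /= !mulrzl; congr (_ *~ _ + _ *~ _); ring.
Qed.

(** The first summand bounds the length [z.1 + z.2] in [crossing_inbox], and the
second one the deviation. *)
Definition tube_radius (kappa Delta : nat) := (kappa * (1 + Delta) + Delta)%N.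

Lemma inbox_real B (z : pt) :
  `|z.1%:~R : R| <= B%:R -> `|z.2%:~R : R| <= B%:R -> inbox B z.
Proof.
by rewrite /inbox -!(ler_nat R) !natr_absz !intr_norm => -> ->.
Qed.

(** Along the line the height grows by at least [1 / kappa] of a letter height per
unit of length, while the deviation moves it by at most [Delta] letter heights;
so the length of [z] is bounded when its height is. *)
Lemma crossing_inbox kappa (alpha : R) Delta z i : admissible kappa ->
  0 <= alpha -> alpha <= 1 -> `|dev alpha z| <= Delta%:R ->
  h z <= 0 -> 0 < h (z + ab [:: i]) -> inbox (tube_radius kappa Delta) z.
Proof.
move=> [h0 _ hr] a0 a1; rewrite raddfD (heightE z) /dev intrD /=.
have := h0 letter1; have := h0 letter2; have := hr letter1 letter1.
have := hr letter1 letter2; have := hr letter2 letter1; have := hr letter2 letter2.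
have := hr i letter1; have := hr i letter2.
move: (h (ab [:: i])) (h (ab [:: letter1])) (h (ab [:: letter2])) => c a b.
move=> cb ca bb ba ab aa b0 a_0 hd hz hzi.
suff [hx hy] : `|z.1%:~R : R| <= (tube_radius kappa Delta)%:R /\
               `|z.2%:~R : R| <= (tube_radius kappa Delta)%:R by exact: inbox_real.
move: hd hz hzi; rewrite /tube_radius natrD natrM natrD.
move: (z.1%:~R : R) (z.2%:~R : R) (kappa%:R : R) (Delta%:R : R) cb ca bb ba ab aa.
move=> x y K D cb ca bb ba ab aa hd hz hzi.
pose M := alpha * a + (1 - alpha) * b; pose k := x + y; pose d := x - alpha * k.
have M0 : 0 < M.
  have [E|n0] := eqVneq alpha 0; first by rewrite /M E; lra.
  have p0 : 0 < alpha by rewrite lt0r n0.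
  rewrite /M; apply: ltr_pwDl; first exact: mulr_gt0.
  by apply: mulr_ge0; lra.
have le_KM t : t <= K * a -> t <= K * b -> t <= K * M.
  move=> ta tb; have -> : t = alpha * t + (1 - alpha) * t by ring.
  rewrite /M mulrDr; apply: lerD; rewrite mulrCA ler_wpM2l //; lra.
have := le_KM _ ca cb; have := le_KM _ aa ab; have := le_KM _ ba bb => bM aM cM.
have hdd : `|d * (a - b)| <= D * (K * M).
  rewrite normrM ler_pM // ler_norml; apply/andP; split; lra.
have kE : x * a + y * b = k * M + d * (a - b) by rewrite /d /k /M; ring.
have kle : `|k| <= K * (1 + D).
  rewrite -(ler_pM2r M0) -[X in `|_| * X](gtr0_norm M0) -normrM ler_norml.
  by move: hdd; rewrite ler_norml => /andP[? ?]; apply/andP; split; lra.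
have xE : x = alpha * k + d by rewrite /d; ring.
have yE : y = (1 - alpha) * k - d by rewrite /d /k; ring.
rewrite xE yE; split.
  apply: le_trans (ler_normD _ _) _; rewrite lerD // normrM (ger0_norm a0).
  by apply: le_trans _ kle; exact: ler_piMl.
apply: le_trans (ler_normB _ _) _; rewrite lerD // normrM ger0_norm; last lra.
by apply: le_trans _ kle; apply: ler_piMl => //; lra.
Qed.
End Config.

(** * Bundles of strands and their itineraries *)

Lemma seq_argmin (R : realDomainType) (T : eqType) (f : T -> R) (K : seq T) :
  K != [::] -> exists2 x, x \in K & forall y, y \in K -> f x <= f y.
Proof.
case: K => // x K _; elim: K x => [|y K IHK] x.
  by exists x => [|z]; rewrite inE // => /eqP ->.
have [z zK zle] := IHK y; have [xz|zx] := leP (f x) (f z).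
  exists x => [|w]; rewrite inE ?eqxx // => /predU1P[->|/zle] //.
  exact: le_trans.
exists z => [|w]; first by rewrite inE zK orbT.
by rewrite inE => /predU1P[->|/zle //]; exact: ltW.
Qed.

Definition edge_box (D : nat) : seq edge :=
  [seq (x, i) | x <- box D, i <- [:: letter1; letter2]].

Lemma mem_edge_box D (e : edge) : inbox D e.1 -> e \in edge_box D.
Proof.
move=> /mem_box eb; apply/allpairsP; exists e; split;
  rewrite -?surjective_pairing //.
by rewrite !inE; case: (letterP e.2) => ->.
Qed.

(** The number of sets of edges in the box, hence a bound for the number of
configurations up to translation. *)
Definition period_bound (D : nat) := #|{: (size (edge_box D)).-tuple bool}|.

Section Bundle.
Context {R : realType} (h : {additive pt -> R}) (kappa : nat) (alpha : R).
Variables (s : word -> word) (Delta : nat) (B : seq (pt * word)).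
Hypothesis h_adm : admissible h kappa.
Hypothesis alpha_ge0 : 0 <= alpha.
Hypothesis alpha_le1 : alpha <= 1.
Hypothesis s_refl : forall e, coincide s e e.
Hypothesis s_letters : ~~ coincide s (0, letter1) (0, letter2).
Hypothesis B_neq0 : B != [::].
Hypothesis B_uniq : uniq B.
Hypothesis B_apart : forall b c e g, b \in B -> c \in B -> b != c ->
  e \in strand b.1 b.2 -> g \in strand c.1 c.2 -> ~~ coincide s e g.
Hypothesis B_tube : forall b e, b \in B -> e \in strand b.1 b.2 ->
  `|dev alpha e.1| <= Delta%:R /\ `|dev alpha (tip e)| <= Delta%:R.
Local Notation D := (tube_radius kappa (Delta + Delta)).
Hypothesis B_max : forall K, config h D s K -> (size K <= size B)%N.

Let h_gt0 : forall i, 0 < h (ab [:: i]). Proof. by case: h_adm. Qed.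
Let h_inj : injective h. Proof. by apply: raddf_inj; case: h_adm. Qed.

(** When [t] is inside the bundle, a cut has exactly one edge on each strand. *)
Definition cut (t : pt) : seq edge :=
  undup [seq e <- flatten [seq strand b.1 b.2 | b <- B] | crosses h (h t) e].

Lemma cutP t e : reflect
  (exists b, [/\ b \in B, e \in strand b.1 b.2 & crosses h (h t) e]) (e \in cut t).
Proof.
rewrite mem_undup mem_filter; apply: (iffP andP).
  by move=> [ec /flatten_mapP[b bB eb]]; exists b.
by move=> [b [bB eb ec]]; split=> //; apply/flatten_mapP; exists b.
Qed.

Definition inside t := forall b, b \in B -> h b.1 <= h t < h (b.1 + ab b.2).

Lemma cut_strand t b : inside t -> b \in B ->
  exists2 e, e \in strand b.1 b.2 & e \in cut t.
Proof.
move=> it bB; have [e eb ec] := strand_crosses (it b bB).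
by exists e => //; apply/cutP; exists b.
Qed.

Lemma coincide_neq e g : ~~ coincide s e g -> e != g.
Proof. by apply: contra => /eqP ->. Qed.

Lemma size_cut t : inside t -> (size B <= size (cut t))%N.
Proof.
move=> it.
pose f b := head (b.1, letter1) [seq e <- strand b.1 b.2 | crosses h (h t) e].
have fP b : b \in B -> f b \in strand b.1 b.2 /\ f b \in cut t.
  move=> bB; have [e eb /cutP[_ [_ _ ec]]] := cut_strand it bB.
  have : e \in [seq e <- strand b.1 b.2 | crosses h (h t) e]
    by rewrite mem_filter ec.
  rewrite /f; case E: [seq e <- strand b.1 b.2 | crosses h (h t) e] =>
    [//|g l] _ /=.
  have : g \in g :: l by rewrite mem_head.
  rewrite -E mem_filter => /andP[gc gb]; split=> //.
  by apply/cutP; exists b.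
rewrite -(size_map f); apply: uniq_leq_size => [|e /mapP[b bB ->]];
  last by case: (fP b bB).
rewrite map_inj_in_uniq // => b c bB cB fbc; apply/eqP/negPn/negP => nbc.
have [fb _] := fP b bB; have [fc _] := fP c cB.
by have /coincide_neq := B_apart bB cB nbc fb fc; rewrite fbc eqxx.
Qed.

Lemma cut_apart t e g : e \in cut t -> g \in cut t -> e != g -> ~~ coincide s e g.
Proof.
move=> /cutP[b [bB eb ec]] /cutP[c [cB gc gcr]] neg.
have [E|nbc] := eqVneq b c; last exact: B_apart nbc eb gc.
rewrite -E in gc; case/eqP: neg; exact: strand_crosses_inj eb gc ec gcr.
Qed.

Definition stop t := `|dev alpha t| <= Delta%:R /\ inside t.

Lemma cut_inbox t e : stop t -> e \in cut t -> inbox D (e.1 - t).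
Proof.
move=> [dt _] /cutP[b [bB eb /andP[e1 e2]]].
have [de _] := B_tube bB eb.
apply: (crossing_inbox (i := e.2) h_adm alpha_ge0 alpha_le1).
- by rewrite raddfB natrD; apply: le_trans (ler_normB _ _) _; rewrite lerD.
- by rewrite raddfB subr_le0.
- by rewrite addrAC -/(tip e) raddfB subr_gt0.
Qed.

(** The lowest tip is unique because heights are injective on lattice points. The
default value 0 is not reached inside the bundle, where cuts are nonempty. *)
Definition next t : pt :=
  let tips := map tip (cut t) in
  nth 0 tips (find (fun x => all (fun y => h x <= h y) tips) tips).

Lemma cut_neq0 t : inside t -> cut t != [::].
Proof.
by move=> /size_cut; rewrite -!size_eq0 -!lt0n; apply: leq_trans;
  rewrite lt0n size_eq0.
Qed.

Lemma nextP t : inside t ->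
  (exists2 e, e \in cut t & next t = tip e) /\
  forall e, e \in cut t -> h (next t) <= h (tip e).
Proof.
move=> it; rewrite /next /=; set tips := map tip (cut t).
have tips0 : tips != [::] by rewrite -size_eq0 size_map size_eq0 cut_neq0.
have [x xt xle] := seq_argmin h tips0.
have has_min : has (fun x => all (fun y => h x <= h y) tips) tips.
  by apply/hasP; exists x => //; apply/allP.
split; last first.
  by move=> e et; have /allP := nth_find 0 has_min; apply; exact: map_f.
have /mapP[e et ->] :
    nth 0 tips (find (fun x => all (fun y => h x <= h y) tips) tips) \in tips.
  by rewrite mem_nth // -has_find.
by exists e.
Qed.

Lemma next_gt t : inside t -> h t < h (next t).
Proof. by move=> it; have [[e /cutP[b [_ _ /andP[_ ht]]] ->] _] := nextP it. Qed.

Lemma next_inbox t : stop t -> inbox D.+1 (next t - t).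
Proof.
move=> st; have [[e et ->] _] := nextP st.2.
by rewrite /tip addrAC -addn1 inboxD ?inbox_ab1 // cut_inbox.
Qed.

Lemma next_stop t : stop t -> (forall b, b \in B -> next t != b.1 + ab b.2) ->
  stop (next t).
Proof.
move=> [dt it] nend; have [[e et ne] nle] := nextP it; split.
  have /cutP[b [bB eb _]] := et; rewrite ne; by have [] := B_tube bB eb.
move=> b bB; have /andP[hb _] := it b bB.
rewrite (le_trans hb) ?(ltW (next_gt it)) //=.
have [g gb /[dup] gt /nle hg] := cut_strand it bB.
rewrite lt_neqAle (inj_eq h_inj) nend //=.
exact: le_trans hg (strand_tip_le h_gt0 gb).
Qed.

Lemma cut_next t e : inside t -> e \in cut (next t) ->
  e.1 = next t \/ e \in cut t /\ tip e != next t.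
Proof.
move=> it /cutP[b [bB eb /andP[e1 e2]]].
have [et|te] := leP (h e.1) (h t).
  right; split; last by apply: contraTneq e2 => ->; rewrite ltxx.
  apply/cutP; exists b; split=> //; rewrite /crosses et /=.
  exact: lt_trans (next_gt it) e2.
left; have [g gb gt] := cut_strand it bB; have /(nextP it).2 hg := gt.
have /cutP[c [_ _ /andP[g1 g2]]] := gt.
apply: h_inj; apply/eqP; rewrite eq_le e1.
by case: (strand_trichotomy h_gt0 gb eb) => [ge||]; [exfalso; move: te;
  rewrite -ge; lra|lra|lra].
Qed.

Lemma cut_keep t e : inside t -> e \in cut t -> tip e != next t ->
  e \in cut (next t).
Proof.
move=> it et ne; have /(nextP it).2 he := et.
have /cutP[b [bB eb /andP[e1 e2]]] := et.
apply/cutP; exists b; split=> //; apply/andP; split.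
  by apply: le_trans e1 (ltW (next_gt it)).
by rewrite lt_neqAle (inj_eq h_inj) eq_sym ne.
Qed.

Definition same_cut (z t t' : pt) := forall e,
  (e \in cut t) = (shift z e \in cut t').

Lemma same_next z t t' : inside t -> inside t' -> same_cut z t t' ->
  next t' = next t + z.
Proof.
move=> it it' st; have [[e et ne] nle] := nextP it;
  have [[e' et' ne'] nle'] := nextP it'.
apply: h_inj; apply/eqP; rewrite eq_le; apply/andP; split.
  by rewrite ne -tip_shift; apply: nle'; rewrite -st.
have e'E : e' = shift z (shift (- z) e') by rewrite shift_shift addNr shift0.
have hD x : h (x + z) = h x + h z by rewrite raddfD.
rewrite ne' e'E tip_shift !hD lerD2r; apply: nle.
by rewrite st -e'E.
Qed.

Lemma same_cutN z t t' : same_cut z t t' -> same_cut (- z) t' t.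
Proof.
by move=> st e; rewrite st shift_shift addNr shift0.
Qed.

Lemma config_cut t : stop t -> config h D s (map (shift (- t)) (cut t)).
Proof.
move=> st; split.
- by rewrite map_inj_uniq ?undup_uniq //; exact: shift_inj.
- move=> _ /mapP[e et ->]; split; first exact: cut_inbox.
  have /cutP[b [_ _ ec]] := et.
  by move: ec; rewrite /crosses tip_shift /= !raddfB subr_le0 subr_gt0.
- move=> _ _ /mapP[e et ->] /mapP[g gt ->];
  rewrite (inj_eq (@shift_inj _)) coincide_shift.
  exact: cut_apart et gt.
Qed.

(** If [shift z e] is in the next cut after [t'] while [e] is not in the one after
[t], then [e] starts at the vertex [next t]. It coincides with no edge of the next
cut after [t]: an edge that starts at the same vertex carries the other letter,
and any other edge was already in the cut at [t], so its translate lies in the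
same cut as [shift z e]. Adding [e] contradicts maximality. *)
Lemma same_cut_next_sub z t t' e : stop t -> stop t' -> stop (next t) ->
  stop (next t') -> same_cut z t t' -> shift z e \in cut (next t') -> e \in cut (next t).
Proof.
move=> st st' sn sn' stt' en'; apply/negPn/negP => en.
have nt := same_next st.2 st'.2 stt'.
(* Otherwise [shift z e] is already in the cut at [t'], so [e] is in the cut at
   [t] and persists to the next one. *)
have e1 : e.1 = next t.
  case: (cut_next st'.2 en') => [/= |[]].
    by rewrite nt => /addIr.
  rewrite -stt' tip_shift nt => et ne; case/negP: en.
  by apply: cut_keep st.2 et _; apply: contraNneq ne => ->.
have apart g : g \in cut (next t) -> ~~ coincide s e g.
  move=> gn; have neg : e != g by apply: contraNneq en => ->.
  case: (cut_next st.2 gn) => [g1|[gt ng]].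
    have -> : e = shift (next t) (0, e.2)
      by rewrite /shift add0r -e1 -surjective_pairing.
    have -> : g = shift (next t) (0, g.2)
      by rewrite /shift add0r -g1 -surjective_pairing.
    have : e.2 != g.2.
      apply: contraNneq neg => E; by rewrite (surjective_pairing e)
        (surjective_pairing g) E e1 g1.
    rewrite coincide_shift; case: (letterP e.2) => ->; case: (letterP g.2) => -> //.
    by rewrite coincide_sym.
  rewrite -(coincide_shift s z); apply: (cut_apart en');
    last by rewrite (inj_eq (@shift_inj _)).
  apply: cut_keep st'.2 _ _; first by rewrite -stt'.
  by rewrite tip_shift nt (inj_eq (addIr _)).
have /B_max : config h D s (shift (- next t) e ::
  map (shift (- next t)) (cut (next t))).
  have [u1 u2 u3] := config_cut sn; split.
  - by rewrite /= u1 mem_shift shift_shift opprK addNr shift0 en.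
  - move=> g; rewrite inE => /predU1P[->|/u2 //].
    split; first by rewrite /= e1 subrr.
    by rewrite /crosses tip_shift /tip /= e1 subrr addrAC subrr add0r raddf0
      lexx h_gt0.
  - have apart' g : g \in map (shift (- next t)) (cut (next t)) ->
        ~~ coincide s (shift (- next t) e) g.
      by move=> /mapP[g0 /apart + ->]; rewrite coincide_shift.
    move=> g k; rewrite !inE => /predU1P[->|gK] /predU1P[->|kK] ngk.
    + by rewrite eqxx in ngk.
    + exact: apart'.
    + by rewrite coincide_sym; exact: apart'.
    + exact: u3.
by rewrite /= size_map ltnNge size_cut //; exact: sn.2.
Qed.

Lemma same_cut_next z t t' : stop t -> stop t' -> stop (next t) -> stop (next t') ->
  same_cut z t t' -> same_cut z (next t) (next t').
Proof.
move=> st st' sn sn' stt' e; apply/idP/idP; last exact: same_cut_next_sub.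
move=> en; apply: (same_cut_next_sub st' st sn' sn (same_cutN stt')).
by rewrite shift_shift subrr shift0.
Qed.

Section Itinerary.
Variable t0 : pt.
Local Notation itin k := (iter k next t0).

Lemma itinerary_inbox k i : (forall a, (a < k)%N -> stop (itin (i + a))) ->
  inbox (k * D.+1) (itin (i + k) - itin i).
Proof.
elim: k => [|k IHk] st; first by rewrite addn0 subrr.
rewrite addnS mulSn -[itin _.+1](subrK (itin (i + k))) -addrA inboxD //.
  by apply: next_inbox; exact: st.
by apply: IHk => a ak; apply: st; exact: ltnW.
Qed.

Lemma itinerary_increasing k i : (0 < k)%N ->
  (forall a, (a < k)%N -> stop (itin (i + a))) -> h (itin i) < h (itin (i + k)).
Proof.
elim: k => // -[_ _ /(_ 0%N isT)|k IHk _ st];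
  first by rewrite addn1 addn0 => /= /proj2/next_gt.
rewrite addnS; apply: lt_trans (next_gt (proj2 (st k.+1 (leqnn _)))).
by apply: IHk => // a ak; apply: st; exact: ltnW.
Qed.

(** Relative to its base vertex a cut is a subset of [edge_box D], encoded by a bit
vector; two of the first cuts have the same code. *)
Lemma itinerary_recurs : (forall k, (k <= period_bound D)%N -> stop (itin k)) ->
  exists i j, [/\ (i < j)%N, (j <= period_bound D)%N &
    same_cut (itin j - itin i) (itin i) (itin j)].
Proof.
move=> st.
pose code k :=
  map_tuple (fun e => shift (itin k) e \in cut (itin k)) (in_tuple (edge_box D)).
have [i [j [ij jP /(congr1 val)/eq_in_map Ecode]]] := pigeonhole code.
exists i, j; split=> // e.
have eE k : e = shift (itin k) (shift (- itin k) e)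
  by rewrite shift_shift addNr shift0.
have zE : shift (itin j - itin i) e = shift (itin j) (shift (- itin i) e).
  by rewrite shift_shift addrC.
have iff_box : inbox D (e.1 - itin i) ->
  (e \in cut (itin i)) = (shift (itin j - itin i) e \in cut (itin j)).
  move=> eb; rewrite zE {1}(eE i); apply: Ecode; exact: mem_edge_box.
apply/idP/idP => [ei|ej].
  by rewrite -iff_box //; apply: cut_inbox ei; apply: st;
    exact: leq_trans (ltnW ij) jP.
rewrite iff_box //; have /= := cut_inbox (st j jP) ej.
by rewrite -addrA [_ - itin j]addrAC subrr add0r.
Qed.

(** Once a cut recurs up to the translation [z], so does everything after it; the
itinerary repeats [z] while it stays in the tube. *)
Lemma itinerary_periodic Q :
  (forall k, (k <= period_bound D * Q.+1)%N -> stop (itin k)) ->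
  exists z, [/\ z != 0, inbox (period_bound D * D.+1) z &
    `|dev alpha z| *+ Q <= (Delta + Delta)%:R].
Proof.
move=> st; have [|i [j [ij jP sij]]] := itinerary_recurs.
  by move=> k kP; apply: st; rewrite mulnS; lia.
have PQ a b : (a <= period_bound D)%N -> (b <= period_bound D * Q)%N ->
  stop (itin (a + b)).
  by move=> aP bP; apply: st; rewrite mulnS leq_add.
set z := itin j - itin i in sij.
have same k : (k <= period_bound D * Q)%N ->
  same_cut z (itin (i + k)) (itin (j + k)).
  elim: k => [|k IHk] kS; first by rewrite !addn0.
  rewrite !addnS /=; apply: same_cut_next; first 4 last.
  - by apply: IHk; exact: ltnW.
  - by apply: PQ; lia.
  - by apply: PQ; lia.
  - by rewrite -iterS -addnS; apply: PQ; lia.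
  - by rewrite -iterS -addnS; apply: PQ; lia.
have step k : (k <= period_bound D * Q)%N -> itin (j + k) = itin (i + k) + z.
  case: k => [|k] kS; first by rewrite !addn0 addrC subrK.
  rewrite !addnS /=; apply: same_next; first 2 last.
  - by apply: same; exact: ltnW.
  - by have [] := PQ i k ltac:(lia) (ltnW kS).
  - by have [] := PQ j k ltac:(lia) (ltnW kS).
have jump q : (q <= Q)%N -> itin (i + q * (j - i)) = itin i + z *+ q.
  elim: q => [|q IHq] qQ; first by rewrite mul0n addn0 addr0.
  have -> : (i + q.+1 * (j - i) = j + q * (j - i))%N by lia.
  rewrite step ?IHq ?(ltnW qQ) -?addrA -?mulrSr //.
  by rewrite mulnC leq_mul //; lia.
exists z; split.
- have : h (itin i) < h (itin (i + (j - i))).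
    apply: itinerary_increasing => [|a ha]; first lia.
    by rewrite -[(i + a)%N]addn0; apply: PQ; lia.
  rewrite subnKC ?(ltnW ij) // => hij; apply: contraTneq hij => z0.
  by rewrite -(subrK (itin i) (itin j)) -/z z0 add0r ltxx.
- have : inbox ((j - i) * D.+1) (itin (i + (j - i)) - itin i).
    by apply: itinerary_inbox => a ha; rewrite -[(i + a)%N]addn0; apply: PQ; lia.
  by rewrite subnKC ?(ltnW ij) //; apply: inboxW; rewrite leq_mul //; lia.
- rewrite -normrMn -raddfMn /=.
  have -> : z *+ Q = itin (i + Q * (j - i)) - itin i by rewrite jump // addrC addKr.
  rewrite raddfB natrD; apply: le_trans (ler_normB _ _) _; apply: lerD.
    have QP : (Q * (j - i) <= period_bound D * Q)%N.
      by rewrite mulnC leq_mul //; lia.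
    by have [] := PQ i (Q * (j - i))%N ltac:(lia) QP.
  by have [] := PQ i 0%N ltac:(lia) isT; rewrite addn0.
Qed.

(** The itinerary can leave the bundle only through the end of a strand, and by
[itinerary_periodic] it does so after a bounded number of steps. *)
Lemma strand_end_near Q : stop t0 ->
  (forall z, z != 0 -> inbox (period_bound D * D.+1) z ->
     (Delta + Delta)%:R < `|dev alpha z| *+ Q) ->
  exists2 b, b \in B &
    inbox ((period_bound D * Q.+1).+1 * D.+1) (b.1 + ab b.2 - t0).
Proof.
move=> st0 Qbig; apply: contrapT => noend.
have [k|z [z0 zb]] := @itinerary_periodic Q; last by rewrite leNgt Qbig.
elim/ltn_ind: k => -[//|k] IHk kS /=.
have stk a : (a <= k)%N -> stop (itin a).
  by move=> ak; apply: IHk; [rewrite ltnS|exact: leq_trans (ltnW kS)].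
apply: next_stop; first exact: stk.
move=> b bB; apply/eqP => E; apply: noend; exists b => //.
rewrite -E -iterS; apply: inboxW (_ : inbox (k.+1 * D.+1) _);
  first by rewrite leq_mul2r; lia.
by apply: (@itinerary_inbox k.+1 0) => a ak; apply: stk.
Qed.

End Itinerary.
End Bundle.

(** * Descent on the number of non-coincident edges *)

Lemma height_word_gt0 (R : realType) (h : {additive pt -> R}) (w : word) :
  (forall i, 0 < h (ab [:: i])) -> w <> [::] -> 0 < h (ab w).
Proof.
move=> h0; case: w => // i w _; rewrite ab_cons raddfD /= ltr_pwDl //.
exact: height_ab.
Qed.

Section Descent.
Variable sigma : nat -> word -> word.
Hypothesis sigma_subst : forall n, substitution (sigma n).
Hypothesis sigma_prim : primitive sigma.
Hypothesis sigma_irr : algebraically_irreducible sigma.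
Local Notation sc := (subst_comp sigma).
Variable C : nat.
Hypothesis sigma_rec : forall l, exists n, [/\ (1 <= n)%N,
  forall k, (k < l)%N -> sigma (n + k)%N =1 sigma k &
  nat_balanced C (language sigma (n + l)%N)].
Hypothesis sigma_apart : forall k, ~~ coincide (sc 0 k) (0, letter1) (0, letter2).
Variable R : realType.

(** A copy of a long prefix contains a copy of a shorter prefix at a positive
position; iterating pushes the copies to infinity. *)
Lemma prefix_recurs N r :
  exists2 n, (N <= n)%N & forall k, (k < r)%N -> sigma (n + k)%N =1 sigma k.
Proof.
elim: N r => [|N IHN] r; first by exists 0%N.
have [n [n0 hn _]] := sigma_rec r; have [n1 Nn1 hn1] := IHN (n + r)%N.
exists (n1 + n)%N => [|k kr w]; first lia.
by rewrite -addnA hn1 ?hn // ltn_add2l.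
Qed.

(** The last [r] substitutions have a positive incidence matrix with entries at most
[kappa], which makes the heights of both letters comparable whatever the other
substitutions do. *)
Lemma admissible_lin (h : {additive pt -> R}) kappa0 kappa m n r :
  admissible h kappa0 -> (m <= n)%N ->
  (forall k, (k < r)%N -> sigma (n + k)%N =1 sigma k) ->
  (forall i j, j \in sc 0 r [:: i]) ->
  (forall i, (size (sc 0 r [:: i]) <= kappa)%N) ->
  admissible (h \o lin (sc m (n + r))) kappa.
Proof.
move=> [h0 hinj _] mn hn rpos rsize.
have ss k l : substitution (sc k l) by exact: subst_comp_substitution.
have ne k l w : w <> [::] -> sc k l w <> [::] by case: (ss k l) => _ _; apply.
have scE i : sc m (n + r) [:: i] = sc m n (sc 0 r [:: i]).
  rewrite (@subst_comp_cat _ m n) ?leq_addr //=.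
  by have := subst_comp_shift hn (leq0n r) [:: i]; rewrite addn0 => ->.
pose g := h \o lin (sc m n) : {additive pt -> R}.
have g0 i : 0 < g (ab [:: i]).
  by rewrite /g /= lin_ab //; apply: height_word_gt0 => //; apply: ne.
have hE i : h (lin (sc m (n + r)) (ab [:: i])) = g (ab (sc 0 r [:: i])).
  by rewrite /g /= !lin_ab // scE.
split.
- move=> i; rewrite /= lin_ab //; apply: height_word_gt0 => //; exact: ne.
- move=> z /= /hinj; rewrite -[0](raddf0 (lin (sc m (n + r)))).
  by move/(lin_inj sigma_subst sigma_irr) => -> //; lia.
- move=> i j; rewrite /= !hE.
  rewrite (heightE g (ab (sc 0 r [:: i]))) (heightE g (ab (sc 0 r [:: j]))).
  have p k a : (0 < count_mem a (sc 0 r [:: k]))%N by rewrite -has_count has_pred1.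
  have le1 k a : 1 <= (count_mem a (sc 0 r [:: k]))%:R :> R by rewrite ler1n p.
  have leK k a : (count_mem a (sc 0 r [:: k]))%:R <= kappa%:R :> R.
    by rewrite ler_nat (leq_trans (count_size _ _)).
  rewrite mulrDr /= -!pmulrn; apply: lerD.
    by apply: ler_pM (ler0n _ _) (ltW (g0 _)) (leK _ _) _; rewrite ler_peMl // ltW.
  by apply: ler_pM (ler0n _ _) (ltW (g0 _)) (leK _ _) _; rewrite ler_peMl // ltW.
Qed.

(** The induction hypothesis at a high level [l'] gives a configuration [K] with
more than [c] edges. Its image at level [m] is a bundle of strands to which
[strand_end_near] applies: the end of some strand is at a bounded distance from
the start of some strand. But their difference is the image of a bounded lattice
vector of positive height, so it is nonzero and much closer to the line than
[dev_gap] allows. *)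
Lemma descent kappa r : (forall i j, j \in sc 0 r [:: i]) ->
  (forall i, (size (sc 0 r [:: i]) <= kappa)%N) ->
  forall c l (h : {additive pt -> R}), admissible h kappa ->
  ~ (forall K, config h (tube_radius kappa (C.+1 + C.+1)) (sc 0 l) K ->
    (size K <= c)%N).
Proof.
move=> rpos rsize; elim=> [|c IHc] l h hadm cle.
  have : config h (tube_radius kappa (C.+1 + C.+1)) (sc 0 l) [:: (0, letter1)].
    split=> // [e|e g]; last by rewrite !inE => /eqP -> /eqP ->; rewrite eqxx.
    rewrite inE => /eqP ->; split=> //.
    by rewrite /crosses /tip /= raddf0 lexx add0r; case: hadm => ->.
  by move/cle.
have ss k k' : substitution (sc k k') by exact: subst_comp_substitution.
have ne k k' w : w <> [::] -> sc k k' w <> [::] by case: (ss k k') => _ _; apply.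
have [n [_ hn bal]] := sigma_rec l; set m := (n + l)%N in bal.
have [alpha [a0 a1 dev_le]] := frequency sigma_subst sigma_prim bal R.
have dev_inj := dev_eq0 sigma_subst sigma_irr dev_le.
set D := tube_radius _ _ in cle IHc *.
have [d1 d1_gt0 gap1] := dev_gap (period_bound D * D.+1) dev_inj.
pose Q := Num.bound ((C.+1 + C.+1)%:R / d1).
have Qbig : (C.+1 + C.+1)%:R < d1 *+ Q.
  rewrite -[ltRHS]mulr_natl -ltr_pdivrMr //; apply: archi_boundP.
  by apply: divr_ge0; rewrite ?ler0n // ltW.
have [d2 d2_gt0 gap2] := dev_gap ((period_bound D * Q.+1).+1 * D.+1) dev_inj.
(* The bound 1 puts the strands in the tube of radius [C + 1]; the bound [d2 / 2]
   contradicts [gap2] at the end. *)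
pose eps0 := Num.min 1 (d2 / 2); pose D2 := (D + D).+1.
have eps0_gt0 : 0 < eps0 by rewrite lt_min ltr01 divr_gt0.
have eps_gt0 : 0 < eps0 / (D2 + D2)%:R by rewrite divr_gt0 // ltr0n.
have [N mN contr] := contraction sigma_subst sigma_prim sigma_irr dev_le eps_gt0.
have [n' Nn' hn'] := prefix_recurs N r.
have mn' : (m <= n')%N by exact: leq_trans Nn'.
set l' := (n' + r)%N; have ml' : (m <= l')%N by exact: leq_trans (leq_addr _ _).
set T := sc m l'; have sT : substitution T by exact: ss.
have T_small x : inbox D2 x -> `|dev alpha (lin T x)| <= eps0.
  have -> : dev alpha (lin T x) = (dev alpha \o lin T) x by [].
  move=> /andP[x1 x2]; rewrite (heightE (dev alpha \o lin T)) /= !lin_ab //.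
  have dT i := contr l' i (leq_trans Nn' (leq_addr r n')).
  have xT (a : int) i : (absz a <= D2)%N ->
      `|a%:~R * dev alpha (ab (T [:: i]))| <= D2%:R * (eps0 / (D2 + D2)%:R).
    by move=> aD; rewrite normrM ler_pM ?dT // -intr_norm -natr_absz ler_nat.
  apply: le_trans (ler_normD _ _) _.
  apply: le_trans (lerD (xT _ _ x1) (xT _ _ x2)) _.
  by rewrite -mulrDl -natrD mulrC divfK // pnatr_eq0.
have [K [Kconf Ksize]] : exists K, config (h \o lin T) D (sc 0 l') K /\
  (c < size K)%N.
  apply: contrapT => noK; refine (IHc l' (h \o lin T) _ _).
    exact: (@admissible_lin h kappa kappa m n' r hadm mn' hn' rpos rsize).
  by move=> K Kconf; rewrite leqNgt; apply/negP => Ksize; apply: noK; exists K.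
have [Kuniq Kcross Kapart] := Kconf.
pose b (e : edge) := (lin T e.1, T [:: e.2]).
have b_end e : (b e).1 + ab (b e).2 = lin T (tip e).
  by rewrite /b /= /tip raddfD /= lin_ab.
have b_apart e g x y : e \in K -> g \in K -> e != g ->
    x \in strand (b e).1 (b e).2 -> y \in strand (b g).1 (b g).2 ->
      ~~ coincide (sc 0 l) x y.
  move=> eK gK neg xe yg; apply: contra (Kapart e g eK gK neg) => co.
  have sc0m : sc 0 m =1 sc 0 n \o sc 0 l.
    move=> w; rewrite (@subst_comp_cat _ 0 n m) ?leq_addr //=.
    by have := subst_comp_shift hn (leq0n l) w; rewrite addn0 => ->.
  have sc0l' : sc 0 l' = sc 0 m \o T by exact: subst_comp_cat.
  rewrite sc0l'; apply: (coincide_sub (ss 0%N m) xe yg).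
  by rewrite (eq_coincide _ _ sc0m); apply: coincide_image.
have b_tube e x : e \in K -> x \in strand (b e).1 (b e).2 ->
    `|dev alpha x.1| <= C.+1%:R /\ `|dev alpha (tip x)| <= C.+1%:R.
  move=> /Kcross[eD _] /strandP[p [q [/= E Ex]]].
  have small u : prefix u (T [:: e.2]) ->
    `|dev alpha (lin T e.1 + ab u)| <= C.+1%:R.
    move=> /prefixW uT; rewrite raddfD -nat1r.
    apply: le_trans (ler_normD _ _) _; apply: lerD.
      apply: le_trans (T_small _ _) _; last by rewrite ge_min lexx.
      by apply: inboxW eD; rewrite /D2; lia.
    by apply: dev_le; apply: lang_infix (lang_sc sigma e.2 ml') uT.
  rewrite /tip Ex; split; first by apply: small; rewrite E prefix_prefix.
  by rewrite -addrA -ab_cat; apply: small;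
    rewrite E cats1 -(cat_rcons _ _ q) prefix_prefix.
have refl x : coincide (sc 0 l) x x.
  have sx : sc 0 l [:: x.2] <> [::] by exact: ne.
  apply/coincideP; case: (sc 0 l [:: x.2]) sx => // i w _.
  by exists (lin (sc 0 l) x.1, i); exact: mem_head.
have b_inj : {in K &, injective b}.
  move=> e g eK gK bE; apply/eqP/negPn/negP => neg.
  have : T [:: e.2] <> [::] by exact: ne.
  case E: (T [:: e.2]) => [//|i w] _.
  have xe : (lin T e.1, i) \in strand (b e).1 (b e).2 by rewrite /= E mem_head.
  have xg := xe; rewrite bE in xg.
  by have := b_apart _ _ _ _ eK gK neg xe xg; rewrite refl.
have K0 : K != [::] by rewrite -size_eq0 -lt0n (leq_ltn_trans _ Ksize).
(* The highest starting point of a strand is inside the bundle, because all edges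
   of [K] cross the same height. *)
have [x0 x0K x0max] := seq_argmin (fun e => - h (lin T e.1)) K0.
have st0 : stop h alpha C.+1 (map b K) (lin T x0.1).
  split.
    apply: le_trans (T_small _ _) _; last by rewrite ge_min ler1n.
    by have [+ _] := Kcross _ x0K; apply: inboxW; rewrite /D2; lia.
  move=> _ /mapP[e eK ->]; rewrite b_end; have := x0max e eK;
    rewrite lerN2 => -> /=.
  have [_ /andP[+ _]] := Kcross _ x0K; have [_ /andP[_ +]] := Kcross _ eK.
  by move=> /=; lra.
have B0 : map b K != [::] by rewrite -size_eq0 size_map size_eq0.
have [//|b1 b2 e g|b1 e|K1 K1c|z z0 zb|_ /mapP[e eK ->]] :=
  @strand_end_near R h kappa alpha (sc 0 l) C.+1 (map b K)
    hadm a0 a1 refl (sigma_apart l) B0 _ _ _ _ (lin T x0.1) Q st0.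
- by rewrite map_inj_in_uniq.
- move=> /mapP[e1 e1K ->] /mapP[e2 e2K ->] nb; apply: b_apart => //.
  by apply: contraNneq nb => ->.
- by move=> /mapP[e1 e1K ->]; exact: b_tube.
- by rewrite size_map; apply: leq_trans Ksize; exact: cle.
- apply: lt_le_trans Qbig _; apply: ler_wMn2r; exact: gap1.
rewrite b_end -raddfB => near.
have zD2 : inbox D2 (tip e - x0.1).
  have [eD _] := Kcross _ eK; have [xD _] := Kcross _ x0K.
  rewrite /tip /D2 -addn1 addnAC; apply: inboxD; last by rewrite inboxN.
  by apply: inboxD => //; exact: inbox_ab1.
have z0 : lin T (tip e - x0.1) = 0.
  apply/eqP/negPn/negP => nz; have := gap2 _ near nz.
  have := T_small _ zD2; rewrite le_min => /andP[_ le2]; lra.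
have [_ /andP[_ +]] := Kcross _ eK; have [_ /andP[+ _]] := Kcross _ x0K.
rewrite /= => h1 h2; have : h (lin T (tip e - x0.1)) = 0 by rewrite z0 raddf0.
rewrite !raddfB /=; lra.
Qed.
End Descent.

(** * Strong coincidence *)

(** The linear form [dev alpha] is injective but takes both signs; shifting the
slope by the integer 2 makes it positive and keeps it injective. *)
Lemma admissible_dev (R : realType) (alpha : R) kappa :
  0 <= alpha -> alpha <= 1 -> (forall z, dev alpha z = 0 -> z = 0) ->
  (3 <= kappa)%N -> admissible (dev (alpha - 2)) kappa.
Proof.
move=> a0 a1 inj k3.
have d1 : dev (alpha - 2) (ab [:: letter1]) = 3 - alpha.
  by rewrite /dev /=; ring.
have d2 : dev (alpha - 2) (ab [:: letter2]) = 2 - alpha.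
  by rewrite /dev /=; ring.
split.
- by move=> i; case: (letterP i) => ->; rewrite ?d1 ?d2; lra.
- move=> z hz; pose k := z.1 + z.2.
  have : dev alpha (z.1 + 2 * k, z.2 - 2 * k) = 0.
    rewrite -hz /dev /= (_ : z.1 + 2 * k + (z.2 - 2 * k) = z.1 + z.2); last by ring.
    by rewrite /dev !(intrD, rmorphN, intrM) /=; ring.
  move=> /inj[]; rewrite /k => h1 h2; rewrite (surjective_pairing z).
  by congr (_, _); lra.
- move=> i j; have k3R : 3 <= kappa%:R :> R by rewrite (ler_nat R 3).
  have le1 : 1 <= dev (alpha - 2) (ab [:: j]) by case: (letterP j) => ->;
    rewrite ?d1 ?d2; lra.
  have le3 : dev (alpha - 2) (ab [:: i]) <= 3 by case: (letterP i) => ->;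
    rewrite ?d1 ?d2; lra.
  by apply: le_trans le3 _; apply: le_trans k3R _; rewrite ler_peMr ?ler0n.
Qed.

Lemma no_coincidence sigma : (forall n, substitution (sigma n)) ->
  ~ strong_coincidence sigma ->
  forall k, ~~ coincide (subst_comp sigma 0 k) (0, letter1) (0, letter2).
Proof.
move=> sigma_subst nsc [|n]; first by rewrite subst_comp_nn.
apply/negP => /coincideP[[x i]].
move=> /strandP[p1 [q1 [/= E1 x1]]] /strandP[p2 [q2 [/= E2 x2]]].
apply: nsc; exists n, i, p1, p2; split.
- by rewrite E1 cats1 -cat_rcons prefix_prefix.
- by rewrite E2 cats1 -cat_rcons prefix_prefix.
- move: x2; rewrite x1 => /addrI abE; apply/colP => j; rewrite !mxE.
  by have [e1 e2] := abE; case: (letterP j) => ->; [case: e1|case: e2].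
Qed.

Lemma balanced_nat (R : archiRealFieldType) (C : R) (L : word -> Prop) :
  balanced C L -> nat_balanced (Num.bound C) L.
Proof.
move=> bal u v Lu Lv suv j; have /andP[_] := bal u v Lu Lv suv j.
rewrite -(ler_nat R) natrD => le_C; rewrite addrC -lerBlDr.
apply: le_trans le_C _; apply: le_trans (ler_norm C) (ltW _).
by have := archi_boundP (normr_ge0 C); rewrite /Num.bound normr_id.
Qed.

Theorem theorem1 (R : archiRealFieldType) (sigma : nat -> word -> word)
    (sigma_subst : forall n : nat, substitution (sigma n))
    (sigma_prim : primitive sigma)
    (sigma_irr : algebraically_irreducible sigma)
    (sigma_rec : exists2 C : R, 0 < C &
       forall l : nat, exists n : nat,
         [/\ (1 <= n)%N,
             forall k : nat, (k < l)%N -> sigma (n + k)%N =1 sigma k &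
             balanced C (language sigma (n + l)%N)]) :
  strong_coincidence sigma.
Proof.
case: sigma_rec => C _ rec; apply: contrapT => /(no_coincidence sigma_subst) apart.
have rec_nat l : exists n, [/\ (1 <= n)%N,
    forall k, (k < l)%N -> sigma (n + k)%N =1 sigma k &
    nat_balanced (Num.bound C) (language sigma (n + l)%N)].
  by have [n [n1 hn /balanced_nat bal]] := rec l; exists n.
have [r _ rpos] := primitive_mem sigma_subst sigma_prim 0.
pose len i := size (subst_comp sigma 0 r [:: i]).
pose kappa := (len letter1 + len letter2 + 3)%N.
have len_le i : (len i <= kappa)%N by rewrite /kappa; case: (letterP i) => ->; lia.
have [n [_ _ bal]] := rec_nat 0%N.
have [alpha [a0 a1 dev_le]] := frequency sigma_subst sigma_prim bal Rdefinitions.R.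
have hadm := admissible_dev a0 a1 (fun z =>
  dev_eq0 sigma_subst sigma_irr dev_le (z := z)) (leq_addl _ 3 : (3 <= kappa)%N).
pose D := tube_radius kappa ((Num.bound C).+1 + (Num.bound C).+1).
apply: (descent sigma_subst sigma_prim sigma_irr rec_nat apart _ len_le
  (c := size (edge_box D)) (l := 0%N) hadm).
  by move=> i j; exact: rpos.
move=> K [Kuniq Kbox _]; apply: uniq_leq_size Kuniq _ => e /Kbox[eD _].
exact: mem_edge_box.
Qed.
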